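(* Let $N$ be an orientable Seifert fibered space with Seifert index $\{v,(o,g);(\alpha_1,\beta_1),\ldots,(\alpha_m,\beta_m)\}$, whose base orbifold has genus $g\ge 1$. Then for any $n$ and any irreducible representation $\rho\colon\pi_1(N)\to\mathrm{SL}_n(\mathbb{C})$, the Reidemeister torsion $\tau_\rho(N)$ is an algebraic integer.
   Context: For a Seifert index $\{v,(o,g);(\alpha_1,\beta_1),\ldots,(\alpha_m,\beta_m)\}$ (closed orientable total space, orientable base of genus $g$, exceptional fibers of type $(\alpha_j,\beta_j)$ with $\alpha_j,\beta_j$ coprime) the fundamental group has the presentation $$\pi_1(N)=\langle a_1,b_1,\ldots,a_g,b_g,q_1,\ldots,q_m,h\mid [a_i,h]=[b_i,h]=[q_j,h]=1,\ q_j^{\alpha_j}h^{\beta_j}=1,\ q_1\cdots q_m[a_1,b_1]\cdots[a_g,b_g]=h^v\rangle .$$ Reidemeister torsion: let $\mathbb{C}^n_\rho$ be $\mathbb{C}^n$ viewed as a $\pi_1(N)$-module via $\rho$. If $\rho$ is acyclic, i.e. $H_*(N;\mathbb{C}^n_\rho)=0$, take a cell decomposition of $N$, let $\mathbf{c}_j$ be the ordered basis of $C_j(N;\mathbb{C}^n_\rho)$ coming from the $j$-cells, choose a basis $\mathbf{b}_j$ of $\mathrm{Im}\,\partial_{j+1}$ and a lift $\widetilde{\mathbf{b}}_j$ of it to $C_{j+1}(N;\mathbb{C}^n_\rho)$, so that $\mathbf{b}_j\widetilde{\mathbf{b}}_{j-1}$ is a basis of $C_j(N;\mathbb{C}^n_\rho)$,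 and set $$\tau_\rho(N)=\prod_{j=0}^3\big(\det[\mathbf{b}_j\widetilde{\mathbf{b}}_{j-1}/\mathbf{c}_j]\big)^{(-1)^{j+1}}\in\mathbb{C}\setminus\{0\},$$ where $[\mathbf{b}_j\widetilde{\mathbf{b}}_{j-1}/\mathbf{c}_j]$ is the change of basis matrix from $\mathbf{c}_j$ to $\mathbf{b}_j\widetilde{\mathbf{b}}_{j-1}$; this is well defined up to sign. If $\rho$ is not acyclic, set $\tau_\rho(N)=0$. The following theorem of Kitano (in this sign/inverse convention for torsion) may be taken as known: since $\rho$ is irreducible, $\rho(h)=\omega I_n$ for an $n$-th root of unity $\omega$; if $e_{j,1},\dots,e_{j,n}$ are the eigenvalues of $\rho(q_j)$ then $$\tau_\rho(N)=\frac{(\omega-1)^{n(m+2g-2)}}{\prod_{j=1}^m(\omega^{\nu_j}e_{j,1}^{\mu_j}-1)\cdots(\omega^{\nu_j}e_{j,n}^{\mu_j}-1)},$$ where $\mu_j,\nu_j\in\mathbb{Z}$ satisfy $\alpha_j\nu_j-\beta_j\mu_j=-1$ and $0<\mu_j<\alpha_j$. An algebraic integer is a complex number that is a root of a monic polynomial over $\mathbb{Z}$. *)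

(* Defs.v *)
From HB Require Import structures.
From mathcomp Require Import all_boot all_order all_algebra.
From mathcomp Require Import reals complex.

Set Implicit Arguments.
Unset Strict Implicit.
Unset Printing Implicit Defensive.

Import GRing.Theory.

Local Open Scope ring_scope.

(* Words in generators and their inverses: the letter (x, false) is x and     *)
(* (x, true) is x^-1. A word is not assumed to be reduced.                    *)
Definition word (X : Type) := seq (X * bool).

Definition winv (X : Type) (w : word X) : word X :=
  rev [seq (l.1, ~~ l.2) | l <- w].

Definition wpow (X : Type) (x : X) (k : int) : word X :=
  nseq `|k|%N (x, k < 0).

Definition wcomm (X : Type) (u w : word X) : word X :=
  u ++ w ++ winv u ++ winv w.

(* The element \sum (-1)^e u of Z[F(X)] is the list of the pairs (e, u).      *)
(* The Fox derivative is characterised by d(uw)/dx = du/dx + u dw/dx and      *)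
(* dy/dx = (y == x), hence d(x^-1)/dx = - x^-1.                               *)
Fixpoint fox (X : eqType) (x : X) (w : word X) : seq (bool * word X) :=
  if w is l :: w' then
    (if l.1 == x then [:: (l.2, if l.2 then [:: l] else [::])] else [::])
      ++ [seq (p.1, l :: p.2) | p <- fox x w']
  else [::].

Definition evalg (G : groupType) (X : Type) (f : X -> G) (w : word X) : G :=
  foldr (fun l x => (if l.2 then (f l.1)^-1 else f l.1) * x)%g 1%g w.

(* The product of the conjugates w r^{+-1} w^-1 listed by the triples         *)
(* (e, w, r), the exponent being -1 when e = true.                            *)
Definition conj_word (X R : Type) (rl : R -> word X)
    (s : seq (bool * word X * R)) : word X :=
  flatten [seq t.1.2 ++ (if t.1.1 then winv (rl t.2) else rl t.2)
                 ++ winv t.1.2 | t <- s].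

(* A 3-dimensional CW complex with a single vertex. Its 1-cells are the       *)
(* generators and its 2-cells are attached along the words [relator r]. The   *)
(* attaching map of a 3-cell, an element of pi_2 of the 2-skeleton, is given  *)
(* by an identity among relations: a product of conjugates of the relators    *)
(* and their inverses that is trivial in the free group on the generators,    *)
(* i.e. under every map to a group.                                           *)
Record cw3 := CW3 {
  gen : finType;
  rel : finType;
  ball : finType;
  relator : rel -> word gen;
  sphere : ball -> seq (bool * word gen * rel);
  sphereP : forall (G : groupType) (f : gen -> G) (b : ball),
    evalg f (conj_word relator (sphere b)) = 1%g
}.

Section Representations.

Variables (K : fieldType) (n : nat) (X : cw3) (rho : gen X -> 'M[K]_n).

Definition wordmx (w : word (gen X)) : 'M[K]_n :=
  foldr (fun l A => (if l.2 then invmx (rho l.1) else rho l.1) *m A) 1%:M w.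

(* rho extends to a homomorphism from the group < gen X | relator > to SL_n.  *)
Definition SL_representation : Prop :=
  (forall x, \det (rho x) = 1) /\ (forall r, wordmx (relator r) = 1%:M).

(* Matrices act on column vectors, while mxalgebra represents a subspace by   *)
(* the row space of U; hence the transposition.                               *)
Definition irreducible_representation : Prop :=
  (0 < n)%N /\
  (forall U : 'M[K]_n,
     (forall w, stablemx U (wordmx w)^T) -> U != 0 -> row_full U).

(* Chains with coefficients in the left module K^n_rho: v (x) g c, where c is *)
(* the chosen lift of a cell to the universal cover, is identified with       *)
(* rho(g)^-1 v (x) c. Chains are row vectors, whence the transposition.       *)
Definition coefmx (s : seq (bool * word (gen X))) : 'M[K]_n :=
  \sum_(p <- s) (-1) ^+ p.1 *: (wordmx (winv p.2))^T.

Definition cellmx (S T : finType) (c : S -> T -> seq (bool * word (gen X))) :=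
  \mxblock_(i < #|S|, j < #|T|) coefmx (c (enum_val i) (enum_val j)).

Definition bd1 := cellmx (fun (x : gen X) (_ : unit) =>
  [:: (false, [:: (x, false)]); (true, [::])]).

Definition bd2 := cellmx (fun (r : rel X) (x : gen X) => fox x (relator r)).

Definition bd3 := cellmx (fun (b : ball X) (r : rel X) =>
  [seq t.1 | t <- sphere b & t.2 == r]).

End Representations.

Section Torsion.

Variables (K : fieldType) (N0 N1 N2 N3 : nat).
Variables (d1 : 'M[K]_(N1, N0)) (d2 : 'M[K]_(N2, N1)) (d3 : 'M[K]_(N3, N2)).

Definition exact_at p N q (d' : 'M[K]_(p, N)) (d : 'M[K]_(N, q)) : bool :=
  (d' == kermx d)%MS.

(* det [b b~ / c], where c is the standard basis of 'rV_N, the rows of b are  *)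
(* a basis of the image of d' and those of b~ lift a basis of the image of d. *)
(* The torsion does not depend on the choice of bases and lifts made here.    *)
(* The stacked matrix is square, so that conform_mx does not return its       *)
(* default value, whenever the complex is exact at 'rV_N.                     *)
Definition basis_det p N q (d' : 'M[K]_(p, N)) (d : 'M[K]_(N, q)) : K :=
  \det (conform_mx (0 : 'M_N) (col_mx (row_base d') (row_base d *m pinvmx d))).

Definition acyclic_complex : bool :=
  [&& exact_at d1 (0 : 'M_(N0, 0)), exact_at d2 d1, exact_at d3 d2
    & exact_at (0 : 'M_(0, N3)) d3].

Definition complex_torsion : K :=
  if acyclic_complex then
    (basis_det d1 (0 : 'M_(N0, 0)))^-1 * basis_det d2 d1
      * (basis_det d3 d2)^-1 * basis_det (0 : 'M_(0, N3)) d3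
  else 0.

End Torsion.

Definition reidemeister_torsion (K : fieldType) (n : nat) (X : cw3)
    (rho : gen X -> 'M[K]_n) : K :=
  complex_torsion (bd1 rho) (bd2 rho) (bd3 rho).

(* Let S be the closed surface of genus g with m + 1 open discs removed. The  *)
(* Seifert space is S x S^1 with m + 1 solid tori glued in, indexed by        *)
(* option 'I_m: Some j is a neighbourhood of the j-th exceptional fibre and   *)
(* None is the one responsible for v. Collapsing S onto a wedge of circles    *)
(* a_i, b_i, q_j gives the cells below: those of (wedge) x S^1, and for each  *)
(* solid torus a meridian disc and a 3-cell. Attaching maps are taken up to   *)
(* homotopy, which preserves the simple homotopy type and hence the torsion.  *)
Section Seifert.

Variables (g m : nat) (v : int) (alpha : 'I_m -> nat) (beta : 'I_m -> int).

Definition wedge : finType := ('I_g + 'I_g + 'I_m)%type.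

Definition seifert_gen : finType := option wedge.
Definition ga (i : 'I_g) : seifert_gen := Some (inl (inl i)).
Definition gb (i : 'I_g) : seifert_gen := Some (inl (inr i)).
Definition gq (j : 'I_m) : seifert_gen := Some (inr j).
Definition gh : seifert_gen := None.

Definition seifert_rel : finType := (wedge + option 'I_m)%type.

Definition meridian (k : option 'I_m) : word seifert_gen :=
  if k is Some j then wpow (gq j) (alpha j)%:Z ++ wpow gh (beta j)
  else flatten [seq [:: (gq j, false)] | j <- enum 'I_m]
       ++ flatten [seq wcomm [:: (ga i, false)] [:: (gb i, false)]
                  | i <- enum 'I_g]
       ++ wpow gh (- v).

Definition seifert_relator (r : seifert_rel) : word seifert_gen :=
  match r with
  | inl x => wcomm [:: (Some x, false)] [:: (gh, false)]
  | inr k => meridian k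
  end.

(* A curve on the boundary of the solid torus that meets the meridian once;   *)
(* with (s, t) the Bezout coefficients, s alpha + t beta = 1.                 *)
Definition core (k : option 'I_m) : word seifert_gen :=
  if k is Some j then
    let: (s, t) := egcdz (alpha j)%:Z (beta j) in wpow (gq j) (- t) ++ wpow gh s
  else [:: (gh, false)].

(* The commutator of u and w as a product of conjugates of the 2-cells        *)
(* [x, h]^{+-1}, when each letter of u commutes with each letter of w because *)
(* one of them is h^{+-1} or both are powers of the same generator. Uses      *)
(*   [x^-1, y] = x^-1 [x, y]^-1 x,  [x, y^-1] = y^-1 [x, y]^-1 y,             *)
(*   [x, y w] = [x, y] . y [x, w] y^-1,  [x u, w] = x [u, w] x^-1 . [x, w].   *)
Definition fill_letters (k l : seifert_gen * bool) :
    seq (bool * word seifert_gen * seifert_rel) :=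
  let c := (if k.2 then [:: k] else [::]) ++ (if l.2 then [:: l] else [::]) in
  match k.1, l.1 with
  | Some x, None => [:: (k.2 (+) l.2, c, inl x)]
  | None, Some y => [:: (~~ (k.2 (+) l.2), c, inl y)]
  | _, _ => [::]
  end.

Definition fill_conj (l : seifert_gen * bool)
    (s : seq (bool * word seifert_gen * seifert_rel)) :=
  [seq (t.1.1, l :: t.1.2, t.2) | t <- s].

Fixpoint fill_letter (k : seifert_gen * bool) (w : word seifert_gen) :=
  if w is l :: w' then fill_letters k l ++ fill_conj l (fill_letter k w')
  else [::].

Fixpoint fill (u w : word seifert_gen) :=
  if u is k :: u' then fill_conj k (fill u' w) ++ fill_letter k w else [::].

(* A solid torus cut along its meridian disc D is a 3-ball bounded by D, its  *)
(* translate by the core, and the boundary torus cut open:                    *)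
(*   (core D core^-1) D^-1 [core, D]^-1 = 1.                                  *)
Definition seifert_sphere (k : option 'I_m) :
    seq (bool * word seifert_gen * seifert_rel) :=
  [:: (false, core k, inr k); (true, [::], inr k)]
    ++ rev [seq (~~ t.1.1, t.1.2, t.2) | t <- fill (core k) (meridian k)].

Section SphereP.

Variables (G : groupType) (f : seifert_gen -> G).

Local Notation ev := (evalg f).
Local Notation prodc s := (ev (conj_word seifert_relator s)).

Let gsimp := (@mulg1 G, @mul1g G, @invg1 G, @invgM G, @invgK G, @mulgA G,
              @mulgV G, @mulVg G, @mulgK G, @mulgVK G).

Let evcat u w : ev (u ++ w) = (ev u * ev w)%g.
Proof. by elim: u => [|l u IHu] /=; rewrite ?mul1g // IHu mulgA. Qed.

Let evinv w : ev (winv w) = (ev w)^-1%g.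
Proof.
elim: w => [|[x e] w IHw]; first by rewrite /= invg1.
rewrite /winv /= rev_cons -cats1 evcat IHw /= mulg1 invgM.
by case: e; rewrite ?invgK.
Qed.

Let prodc_cons t s : prodc (t :: s) =
  (ev t.1.2 * (if t.1.1 then (ev (seifert_relator t.2))^-1
               else ev (seifert_relator t.2)) / ev t.1.2 * prodc s)%g.
Proof.
rewrite /conj_word /= !evcat evinv !mulgA.
by case: t.1.1; rewrite ?evinv.
Qed.

Let prodc_cat s1 s2 : prodc (s1 ++ s2) = (prodc s1 * prodc s2)%g.
Proof. by rewrite /conj_word map_cat flatten_cat evcat. Qed.

Let prodc_conj l s : prodc (fill_conj l s) = (ev [:: l] * prodc s / ev [:: l])%g.
Proof.
elim: s => [|t s IHs]; first by rewrite /= !mulg1 mulgV.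
rewrite [fill_conj _ _]/= !prodc_cons IHs /= !mulg1 !invgM !mulgA.
by rewrite !mulgVK.
Qed.

Let prodc_inv s : prodc (rev [seq (~~ t.1.1, t.1.2, t.2) | t <- s]) = (prodc s)^-1%g.
Proof.
elim: s => [|t s IHs]; first by rewrite /= invg1.
rewrite /= rev_cons -cats1 prodc_cat IHs !prodc_cons /=.
by case: t.1.1; rewrite /= !gsimp.
Qed.

Let commuting (k l : seifert_gen * bool) :=
  [|| k.1 == gh, l.1 == gh | k.1 == l.1].

Let ev_comm u w : ev (wcomm u w) = (ev u * ev w / ev u / ev w)%g.
Proof. by rewrite /wcomm !evcat !evinv !mulgA. Qed.

Let prodc_letters k l : commuting k l ->
  prodc (fill_letters k l) = ev (wcomm [:: k] [:: l]).
Proof.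
case: k l => [[x|] e] [[y|] d]; rewrite /commuting /= ?orbT ?orbF.
- case/eqP=> ->; rewrite /fill_letters.
  by case: e d => [] []; rewrite /= !gsimp.
- move=> _; rewrite /fill_letters prodc_cons.
  by case: e d => [] []; rewrite /= !gsimp.
- move=> _; rewrite /fill_letters prodc_cons.
  by case: e d => [] []; rewrite /= !gsimp.
- move=> _; rewrite /fill_letters.
  by case: e d => [] []; rewrite /= !gsimp.
Qed.

Let prodc_fill_letter k w : all (commuting k) w ->
  prodc (fill_letter k w) = ev (wcomm [:: k] w).
Proof.
elim: w => [_|l w IHw /andP[ckl ckw]].
  by rewrite ev_comm /= !mulg1 mulgV invg1 mulg1.
rewrite prodc_cat prodc_letters // prodc_conj IHw // -(cat1s l w) !ev_comm evcat.
by move: (ev [:: k]) (ev [:: l]) (ev w) => a b c; rewrite !gsimp.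
Qed.

Let prodc_fill u w : all (fun k => all (commuting k) w) u ->
  prodc (fill u w) = ev (wcomm u w).
Proof.
elim: u => [_|k u IHu /andP[ckw cuw]].
  by rewrite ev_comm /= mul1g invg1 mulg1 mulgV.
rewrite prodc_cat prodc_conj IHu // prodc_fill_letter // -(cat1s k u) !ev_comm evcat.
by move: (ev [:: k]) (ev u) (ev w) => a b c; rewrite !gsimp.
Qed.

Let core_meridian k :
  all (fun l => all (commuting l) (meridian k)) (core k).
Proof.
case: k => [j|] /=; last by rewrite andbT; apply/allP.
case: egcdz => s t; rewrite all_cat !all_nseq !all_cat !all_nseq /commuting /=.
by rewrite !eqxx !orbT.
Qed.

Lemma seifert_sphereP k :
  ev (conj_word seifert_relator (seifert_sphere k)) = 1%g.
Proof.
rewrite prodc_cat prodc_inv prodc_fill ?core_meridian // !prodc_cons ev_comm.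
by rewrite /= !gsimp.
Qed.

End SphereP.

Definition seifert_space : cw3 := CW3 seifert_sphereP.

End Seifert.

(* Main.v *)
(* By Schur's lemma h acts by a scalar omega, and omega is a root of unity.    *)
(* Put delta = omega^-1 - 1. Split the cells by setting the wedge apart from h *)
(* in degree 1 and from the meridian discs in degree 2: the h-row of d1 is     *)
(* delta, the wedge block of d2 is - delta, and the meridian block of d3 is    *)
(* diagonal with entries C_k^-1 - 1, where C_k is the image of the core of the *)
(* k-th solid torus. Hence, when delta != 0 and the complex is acyclic, the    *)
(* torsion is, up to sign, delta ^ (n (2 g + m - 1)) / prod_k det (C_k^-1 - 1).*)
(* Since C_k ^ alpha_k = omega, the quotient of delta ^ n by the factor of k   *)
(* is the determinant of the geometric sum of the C_k^-i, i < alpha_k, which   *)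
(* is an algebraic integer because C_k has finite order; the m + 1 factors     *)
(* leave the exponent n (2 g - 2) >= 0 on delta. When delta = 0, a rank count  *)
(* shows that acyclicity forces g = 1 and every C_k = 1; then all the q_j are  *)
(* trivial and a_1, b_1 commute, so that rho is scalar, hence trivial of       *)
(* dimension 1, and d1 = 0 contradicts acyclicity.                             *)

Require Import Defs.
From mathcomp Require Import all_boot all_order all_algebra.
From mathcomp Require Import reals complex.
From mathcomp Require Import ring zify.

Set Implicit Arguments.
Unset Strict Implicit.
Unset Printing Implicit Defensive.

Import GRing.Theory.

Local Open Scope ring_scope.

(** Three block determinants determine the torsion of an acyclic complex split in this way
    ([complex_torsion_split]); [fibre_bd1], [wedge_bd2] and [meridian_bd3] compute the blocks. The
    wedge contributes n (2 g + m) factors delta to the numerator. The denominator consists of delta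
    ^ n, from h, and of one determinant for each of the m + 1 solid tori.

    Integrality comes from (C - 1) (1 + C + ... + C^(k-1)) = C^k - 1. With C the inverse of the
    image of a core and k its multiplicity, the right side is the scalar delta, so each torus
    determinant divides delta ^ n, with a quotient that is integral by [integral_det_geometric].
    What remains is delta to the power n (2 g - 2), and g >= 1 keeps this exponent nonnegative.
    Since omega ^ n = 1, delta is integral as well ([nondegenerate_integral]).

    If omega = 1, no representation is acyclic ([degenerate_not_acyclic]), and the torsion is 0 by
    convention. *)

(** * Torsion of a based complex through complementary blocks *)

Section AbstractTorsion.
Variable K : fieldType.

Lemma exact_rank p N q (d' : 'M[K]_(p, N)) (d : 'M[K]_(N, q)) :
  exact_at d' d -> (\rank d' + \rank d = N)%N.
Proof.
move=> /eqmxP ex; rewrite ex mxrank_ker.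
by rewrite subnK // rank_leq_row.
Qed.

Lemma exact_mul0 p N q (d' : 'M[K]_(p, N)) (d : 'M[K]_(N, q)) :
  exact_at d' d -> d' *m d = 0.
Proof. by case/andP=> /sub_kermxP. Qed.

Lemma row_base_lift N q (d : 'M[K]_(N, q)) :
  row_base d *m pinvmx d *m d = row_base d.
Proof. by rewrite mulmxKpV // (eq_row_base d). Qed.

(** Applying d to a relation among the stacked rows kills the part in the image of d', so the
    coefficients of the lifts vanish, and then the others. *)
Lemma basis_det_neq0 p N q (d' : 'M[K]_(p, N)) (d : 'M[K]_(N, q)) :
  exact_at d' d -> basis_det d' d != 0.
Proof.
move=> ex; have sz := exact_rank ex; have d'd := exact_mul0 ex.
have b'd : row_base d' *m d = 0.
  by apply/sub_kermxP; rewrite (eq_row_base d'); apply/sub_kermxP.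
have free' : row_free (row_base d') by exact: row_base_free.
have freeb : row_free (row_base d) by exact: row_base_free.
have := row_base_lift d; rewrite /basis_det.
move: free' freeb b'd (row_base d *m pinvmx d).
move: (row_base d') (row_base d); move: (\rank d') (\rank d) sz => r s sz.
subst N => b' b free' freeb b'd l ld.
rewrite conform_mx_id -unitfE -[_ \is a _]/(_ \in unitmx) -row_free_unit.
rewrite -kermx_eq0; apply/eqP/row_matrixP=> i; rewrite row0.
have: row i (kermx (col_mx b' l)) *m col_mx b' l = 0.
  by rewrite -row_mul mulmx_ker row0.
rewrite -[row i _]hsubmxK; move: (lsubmx _) (rsubmx _) => u1 u2.
rewrite mul_row_col => E.
have u2_0 : u2 = 0.
  apply: (row_free_inj freeb); rewrite mul0mx -ld mulmxA.
  have /(congr1 (mulmx^~ d)) := E.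
  by rewrite mul0mx mulmxDl -mulmxA b'd mulmx0 add0r.
have u1_0 : u1 = 0.
  by apply: (row_free_inj free'); rewrite mul0mx -E u2_0 mul0mx addr0.
by rewrite u1_0 u2_0 row_mx0.
Qed.

(* The junk value when m <> n is \det 0. *)
Definition sqdet m n (A : 'M[K]_(m, n)) : K := \det (conform_mx (0 : 'M_n) A).

(* The stacked matrix of basis_det times [P | d P'] is block triangular. *)
Lemma basis_det_split p N q r s (d' : 'M[K]_(p, N)) (d : 'M[K]_(N, q))
    (P : 'M_(N, r)) (P' : 'M_(q, s)) :
  exact_at d' d -> \rank d' = r -> \rank d = s ->
  basis_det d' d * sqdet (row_mx P (d *m P'))^T =
  sqdet (row_base d' *m P) * sqdet (row_base d *m P').
Proof.
move=> ex rd' rd; have sz := exact_rank ex; have d'd := exact_mul0 ex.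
have b'd : row_base d' *m d = 0.
  by apply/sub_kermxP; rewrite (eq_row_base d'); apply/sub_kermxP.
have := row_base_lift d; rewrite /basis_det.
move: b'd (row_base d *m pinvmx d).
move: (row_base d') (row_base d); move: (\rank d') (\rank d) rd rd' sz => r' s' -> ->.
move=> sz; subst N => b' b b'd l ld.
rewrite /sqdet !conform_mx_id det_tr -det_mulmx mul_col_row !mulmxA b'd mul0mx ld.
by rewrite det_lblock.
Qed.

Lemma orthogonal_det N (A : 'M[K]_N) : A *m A^T = 1%:M -> \det A ^+ 2 = 1.
Proof. by move=> AAt; rewrite expr2 -{2}det_tr -det_mulmx AAt det1. Qed.

Lemma orthogonal_splitP r s N (I : 'M[K]_(r, N)) (J : 'M[K]_(s, N)) :
  I *m I^T = 1%:M -> I *m J^T = 0 -> J *m J^T = 1%:M ->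
  (col_mx I J) *m (col_mx I J)^T = 1%:M.
Proof.
move=> II IJ JJ.
rewrite tr_col_mx mul_col_row II IJ JJ -[J *m I^T]trmxK trmx_mul trmxK IJ trmx0.
by rewrite -scalar_mx_block.
Qed.

(** Multiplying by the orthogonal matrix with rows I and J makes [I^T | d P'] block triangular. The
    sign e is the determinant of that matrix. *)
Lemma split_det N q r s (I : 'M[K]_(r, N)) (J : 'M[K]_(s, N))
    (d : 'M[K]_(N, q)) (P' : 'M_(q, s)) :
  (r + s = N)%N ->
  I *m I^T = 1%:M -> I *m J^T = 0 -> J *m J^T = 1%:M ->
  exists2 e : K, e ^+ 2 = 1 &
    sqdet (row_mx I^T (d *m P'))^T = e * \det (J *m d *m P').
Proof.
move=> sz II IJ JJ; have EE := orthogonal_splitP II IJ JJ.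
subst N; exists (\det (col_mx I J)); first exact: orthogonal_det.
rewrite /sqdet conform_mx_id det_tr.
have JI : J *m I^T = 0 by rewrite -[LHS]trmxK trmx_mul trmxK IJ trmx0.
have : \det (col_mx I J *m row_mx I^T (d *m P')) = \det (J *m d *m P').
  by rewrite mul_col_row II JI !mulmxA det_ublock det1 mul1r.
rewrite det_mulmx => <-; rewrite mulrA -expr2.
by rewrite orthogonal_det // mul1r.
Qed.

Variables (N0 N1 N2 N3 w : nat).
Variables (d1 : 'M[K]_(N1, N0)) (d2 : 'M[K]_(N2, N1)) (d3 : 'M[K]_(N3, N2)).
Variables (I1 : 'M[K]_(w, N1)) (J1 : 'M[K]_(N0, N1)).
Variables (I2 : 'M[K]_(w, N2)) (J2 : 'M[K]_(N3, N2)).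
Hypotheses (sz1 : (w + N0 = N1)%N) (sz2 : (w + N3 = N2)%N).
Hypotheses (II1 : I1 *m I1^T = 1%:M) (IJ1 : I1 *m J1^T = 0).
Hypotheses (JJ1 : J1 *m J1^T = 1%:M) (II2 : I2 *m I2^T = 1%:M).
Hypotheses (IJ2 : I2 *m J2^T = 0) (JJ2 : J2 *m J2^T = 1%:M).
Hypothesis acyc : acyclic_complex d1 d2 d3.

Let ex0 : exact_at d1 (0 : 'M_(N0, 0)). Proof. by case/and4P: acyc. Qed.
Let ex1 : exact_at d2 d1. Proof. by case/and4P: acyc. Qed.
Let ex2 : exact_at d3 d2. Proof. by case/and4P: acyc. Qed.
Let ex3 : exact_at (0 : 'M_(0, N3)) d3. Proof. by case/and4P: acyc. Qed.

Lemma acyclic_rank1 : \rank d1 = N0.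
Proof. by have := exact_rank ex0; rewrite mxrank0 addn0. Qed.

Let rank2 : \rank d2 = w.
Proof. by apply: (@addIn N0); rewrite sz1 -acyclic_rank1; apply: exact_rank. Qed.

Let rank3 : \rank d3 = N3.
Proof. by have := exact_rank ex3; rewrite mxrank0. Qed.

(** [basis_det_split] in each degree expresses the basis determinants by minors of the row bases of
    d1, d2, d3. Each minor occurs in two consecutive degrees and cancels in the alternating product.
    The identity is free of division, so no block is assumed invertible. *)
Lemma complex_torsion_split :
  exists2 e : K, e ^+ 2 = 1 &
    complex_torsion d1 d2 d3 * \det (d3 *m J2^T) * \det (J1 *m d1)
      = e * \det (I2 *m d2 *m I1^T).
Proof.
have B0 := basis_det_neq0 ex0; have B2 := basis_det_neq0 ex2.
have IJ2' : J2 *m I2^T = 0 by rewrite -[LHS]trmxK trmx_mul trmxK IJ2 trmx0.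
have sz2' : (N3 + w = N2)%N by rewrite addnC.
have orth1 N : (1%:M : 'M[K]_N) *m 1%:M^T = 1%:M by rewrite trmx1 mulmx1.
have orth0 N : (0 : 'M[K]_(0, N)) *m 0^T = 1%:M by apply/matrixP=> -[].
have orth10 : (1%:M : 'M[K]_N0) *m (0 : 'M_(0, N0))^T = 0 by rewrite trmx0 mulmx0.
have [e0' e0_2 E0] := split_det (0 : 'M_(N0, 0)) (0 : 'M_(0, 0))
  (addn0 _) (orth1 N0) orth10 (orth0 N0).
have [e1 e1_2 E1] := split_det d1 (1%:M : 'M_N0) sz1 II1 IJ1 JJ1.
have [e2 e2_2 E2] := split_det d2 I1^T sz2' JJ2 IJ2' II2.
have [e3 e3_2 E3] := split_det d3 J2^T
  (add0n _) (orth0 N3) (mul0mx _ _) (orth1 N3).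
(* In degrees 0 to 3, the P' of each degree is the P of the degree below, so that the same minors
   recur. *)
have := basis_det_split (1%:M : 'M_N0) (0 : 'M_(0,0)) ex0 acyclic_rank1 (mxrank0 _ _ _).
have := basis_det_split I1^T 1%:M ex1 rank2 acyclic_rank1.
have := basis_det_split J2^T I1^T ex2 rank3 rank2.
have := basis_det_split (0 : 'M_(0, N3))^T J2^T ex3 (mxrank0 _ _ _) rank3.
rewrite -{3}(trmx1 _ N0) E0 E1 E2 E3 !mulmx1 mul1mx /complex_torsion acyc.
rewrite [sqdet (row_base 0 *m 0^T)]det_mx00 [sqdet (row_base 0 *m 0)]det_mx00.
rewrite det_mx00.
rewrite !mulr1 mul1r.
move: (basis_det _ d3) (\det (d3 *m _)) (sqdet _) B2 => B3 D x2 B2 F3.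
move: (basis_det d3 d2) B2 (\det (I2 *m _ *m _)) (sqdet _) => B2 nzB2 a x1 F2.
move: (basis_det d2 d1) (\det (J1 *m _)) (sqdet _) => B1 j x0 F1.
move: (basis_det _ _) B0 => B0 nzB0 F0.
have sq_id (e x y : K) : e ^+ 2 = 1 -> e * x = y -> x = e * y.
  by move=> e2E <-; rewrite mulrA -expr2 e2E mul1r.
exists (e0' * e1 * e2 * e3); first by rewrite !exprMn e0_2 e1_2 e2_2 e3_2 !mulr1.
have {}F3 : B3 * D = e3 * x2 by apply: sq_id => //; rewrite mulrCA.
have {}F1 : B1 * j = e1 * (x1 * x0) by apply: sq_id => //; rewrite mulrCA.
(* Only the basis determinants of degrees 0 and 2 are inverted, never a minor. *)
rewrite [LHS](_ : _ = B0^-1 * B2^-1 * (B1 * j) * (B3 * D)); last first.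
  by field; rewrite nzB2 nzB0.
rewrite F3 F1 -F0.
transitivity (e0' * e1 * e3 * (B2^-1 * (x2 * x1))).
  by field; rewrite nzB2 nzB0.
by rewrite -F2; field; rewrite nzB2.
Qed.

(** The wedge part of d2 then lands in the span of J1, so at least w - N0 independent cycles are
    supported on I2. By exactness they bound 3-chains, which lie in the kernel of d3 J2^T. *)
Lemma degenerate_split : I2 *m d2 *m I1^T = 0 ->
  (\rank (d3 *m J2^T) + w <= N3 + N0)%N.
Proof.
move=> d2_0.
have split1 : I1^T *m I1 + J1^T *m J1 = 1%:M.
  have := orthogonal_splitP II1 IJ1 JJ1; move: I1 J1; case: _ / sz1 => I J IJ.
  by rewrite -(mulmx1C IJ) tr_col_mx mul_row_col.
have rk : (\rank (I2 *m d2) <= N0)%N.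
  rewrite -[I2 *m d2]mulmx1 -split1 mulmxDr mulmxA d2_0 mul0mx add0r mulmxA.
  by rewrite (leq_trans (mxrankM_maxr _ _)) ?rank_leq_row.
(* The rows of k I2 are the cycles supported on I2; those of Y are 3-chains that they bound. *)
pose k := kermx (I2 *m d2); pose Y := k *m I2 *m pinvmx d3.
have Yd3 : Y *m d3 = k *m I2.
  rewrite mulmxKpV //; have /andP[_] := ex2; apply: submx_trans.
  by apply/sub_kermxP; rewrite -mulmxA mulmx_ker.
have kE : \rank (k *m I2) = (w - \rank (I2 *m d2))%N.
  rewrite mxrankMfree ?mxrank_ker //.
  by apply/row_freeP; exists I2^T.
have rY : (\rank (k *m I2) <= \rank Y)%N by rewrite -Yd3 mxrankM_maxl.
have : (\rank Y <= \rank (kermx (d3 *m J2^T)))%N.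
  by apply: mxrankS; apply/sub_kermxP; rewrite mulmxA Yd3 -mulmxA IJ2 mulmx0.
have := rank_leq_row (d3 *m J2^T).
rewrite mxrank_ker; lia.
Qed.

End AbstractTorsion.

(** * Block matrices indexed by cells *)

Lemma det_mxdiag (A : comNzRingType) p (p_ : 'I_p -> nat) (B : forall i, 'M[A]_(p_ i)) :
  \det (\mxdiag_i B i) = \prod_i \det (B i).
Proof.
elim: p p_ B => [|p IHp] p_ B.
  have det_size0 k (M : 'M[A]_k) : k = 0%N -> \det M = 1.
    by move=> k0; subst k; rewrite det_mx00.
  by rewrite [RHS]big_ord0 det_size0 // big_ord0.
rewrite mxdiag_recl [RHS]big_ord_recl -IHp.
have det_castmx k l (e : k = l) (M : 'M[A]_k) : \det (castmx (e, e) M) = \det M.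
  by case: _ / e; rewrite castmx_id.
by rewrite det_castmx det_ublock.
Qed.

Section CellBlocks.
Variables (A : comNzRingType) (n : nat).

Definition cellblk (S T : finType) (F : S -> T -> 'M[A]_n) :=
  \mxblock_(i < #|S|, j < #|T|) F (enum_val i) (enum_val j).

Lemma eq_cellblk (S T : finType) (F G : S -> T -> 'M[A]_n) :
  F =2 G -> cellblk F = cellblk G.
Proof. by move=> FG; apply/eq_mxblockP=> i j; rewrite FG. Qed.

Lemma cellblk_inj (S T : finType) (F G : S -> T -> 'M[A]_n) :
  cellblk F = cellblk G -> F =2 G.
Proof.
rewrite /cellblk => /eq_mxblockP FG x y.
by have := FG (enum_rank x) (enum_rank y); rewrite !enum_rankK.
Qed.

Lemma cellblk0 (S T : finType) : cellblk (fun (_ : S) (_ : T) => 0) = 0.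
Proof. exact: mxblock0. Qed.

Lemma mul_cellblk (S T U : finType) (F : S -> T -> 'M[A]_n) (G : T -> U -> 'M[A]_n) :
  cellblk F *m cellblk G = cellblk (fun s u => \sum_t F s t *m G t u).
Proof.
rewrite mul_mxblock; apply/eq_mxblockP=> i k.
by rewrite [RHS](reindex (@enum_val T predT)) //; apply/onW_bij/enum_val_bij.
Qed.

Lemma tr_cellblk (S T : finType) (F : S -> T -> 'M[A]_n) :
  (cellblk F)^T = cellblk (fun t s => (F s t)^T).
Proof. exact: tr_mxblock. Qed.

Lemma cellblk_diagE (S : finType) (F : S -> 'M[A]_n) :
  cellblk (fun s t => if s == t then F s else 0) = \mxdiag_i F (enum_val i).
Proof.
apply/eq_mxblockP=> i j; rewrite (inj_eq enum_val_inj).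
by case: eqP => // ->; rewrite conform_mx_id.
Qed.

Lemma cellblk_scalar (S : finType) a :
  cellblk (fun s t : S => if s == t then a%:M else 0) = a%:M.
Proof. by rewrite cellblk_diagE mxdiagZ. Qed.

Lemma det_cellblk_diag (S : finType) (F : S -> 'M[A]_n) :
  \det (cellblk (fun s t => if s == t then F s else 0)) = \prod_s \det (F s).
Proof.
rewrite cellblk_diagE det_mxdiag.
by rewrite [RHS](reindex (@enum_val S predT)) //; apply/onW_bij/enum_val_bij.
Qed.

(** The rows form the standard coordinate blocks of the cells f s, so multiplying by it or by its
    transpose extracts blocks of a boundary matrix. *)
Definition select (S T : finType) (f : S -> T) :=
  cellblk (fun s t => if f s == t then 1%:M else 0).

Lemma select_mul (S T U : finType) (f : S -> T) (F : T -> U -> 'M[A]_n) :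
  select f *m cellblk F = cellblk (fun s => F (f s)).
Proof.
rewrite mul_cellblk; apply: eq_cellblk => s u.
rewrite (bigD1 (f s)) //= eqxx mul1mx big1 ?addr0 // => t.
by rewrite eq_sym => /negPf->; rewrite mul0mx.
Qed.

Lemma mul_select_tr (S T U : finType) (f : S -> T) (F : U -> T -> 'M[A]_n) :
  cellblk F *m (select f)^T = cellblk (fun u s => F u (f s)).
Proof.
by apply: trmx_inj; rewrite trmx_mul trmxK !tr_cellblk select_mul.
Qed.

Lemma select_orthonormal (S T : finType) (f : S -> T) :
  injective f -> select f *m (select f)^T = 1%:M.
Proof.
move=> f_inj; rewrite mul_select_tr -cellblk_scalar.
by apply: eq_cellblk => s t; rewrite (inj_eq f_inj).
Qed.

Lemma select_orthogonal (S S' T : finType) (f : S -> T) (f' : S' -> T) :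
  (forall s s', f s != f' s') -> select f *m (select f')^T = 0.
Proof.
move=> ff'; rewrite mul_select_tr -cellblk0.
by apply: eq_cellblk => s t; rewrite (negPf (ff' _ _)).
Qed.

End CellBlocks.
Arguments select {A n S T}.

(** * Evaluation of words and Schur's lemma *)

Section Words.
Variables (K : fieldType) (n : nat) (X : cw3) (rho : gen X -> 'M[K]_n.+1).
Hypothesis rho_unit : forall x, rho x \is a GRing.unit.

Lemma wordmx_cons x e w :
  wordmx rho ((x, e) :: w) = (if e then (rho x)^-1 else rho x) * wordmx rho w.
Proof. by []. Qed.

Lemma wordmx_cat u w : wordmx rho (u ++ w) = wordmx rho u * wordmx rho w.
Proof.
elim: u => [|[x e] u IHu]; first by rewrite mul1r.
by rewrite cat_cons !wordmx_cons IHu mulrA.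
Qed.

Lemma wordmx1 x e : wordmx rho [:: (x, e)] = if e then (rho x)^-1 else rho x.
Proof. by rewrite wordmx_cons [wordmx _ _]/= mulr1. Qed.

Lemma wordmx_unit w : wordmx rho w \is a GRing.unit.
Proof.
elim: w => [|[x e] w IHw]; first exact: unitr1.
by rewrite wordmx_cons unitrMl //; case: e; rewrite ?unitrV.
Qed.

Lemma wordmx_inv w : wordmx rho (winv w) = (wordmx rho w)^-1.
Proof.
elim: w => [|[x e] w IHw]; first by rewrite [LHS]/= -[1%:M]/(1 : 'M_n.+1) invr1.
rewrite /winv [map _ _]/= rev_cons -cats1 wordmx_cat IHw wordmx1 wordmx_cons.
rewrite invrM ?wordmx_unit //.
  by case: e; rewrite ?invrK.
by case: e; rewrite ?unitrV.
Qed.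

Lemma wordmx_wpow x k : wordmx rho (wpow x k) = rho x ^ k.
Proof.
have nseqE e j : wordmx rho (nseq j (x, e)) = (if e then (rho x)^-1 else rho x) ^+ j.
  by elim: j => [|j IHj]; rewrite ?expr0 // exprS -IHj.
rewrite /wpow nseqE; case: k => k //=.
by rewrite NegzE exprVn.
Qed.

Lemma wordmx_commute (A : 'M[K]_n.+1) w :
  (forall x, GRing.comm A (rho x)) -> GRing.comm A (wordmx rho w).
Proof.
move=> A_rho; elim: w => [|[x e] w IHw]; first exact: commr1.
rewrite wordmx_cons; apply: commrM => //; case: e => //.
exact: commrV.
Qed.

Lemma wordmx_trivial w : (forall l, l \in w -> rho l.1 = 1) -> wordmx rho w = 1.
Proof.
elim: w => // -[x e] w IHw lw; rewrite wordmx_cons (lw (x, e)) ?mem_head //.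
by rewrite invr1 if_same mul1r IHw // => l l_w; rewrite lw // inE l_w orbT.
Qed.

Lemma commutator_comm x y :
  wordmx rho (wcomm [:: (x, false)] [:: (y, false)]) = 1 ->
  GRing.comm (rho x) (rho y).
Proof.
rewrite /wcomm !wordmx_cat !wordmx_inv !wordmx1 !mulrA => E.
have /(congr1 (fun M => M * rho y * rho x)) := E.
by rewrite mulrVK // mulrVK // mul1r.
Qed.

End Words.

(** An eigenspace of A^T is nonzero and stable under the transposed representation, hence the whole
    space. *)
Lemma Schur_scalar (K : closedFieldType) n (X : cw3) (rho : gen X -> 'M[K]_n.+1)
    (A : 'M[K]_n.+1) :
  (forall x, rho x \is a GRing.unit) -> irreducible_representation rho ->
  (forall x, GRing.comm A (rho x)) -> exists a, A = a%:M.
Proof.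
move=> rho_unit [_ irr] A_rho.
have [a] : exists a, root (char_poly A^T) a.
  by apply/closed_rootP; rewrite size_char_poly.
rewrite -eigenvalue_root_char => eig; exists a.
have := irr (eigenspace A^T a) _ eig.
rewrite -sub1mx => full; have /eigenspaceP : (1%:M <= eigenspace A^T a)%MS.
  apply: full => w; apply: comm_mx_stable_eigenspace.
  rewrite /comm_mx -!trmx_mul; congr trmx; apply: esym.
  exact: wordmx_commute.
by rewrite mul1mx scalemx1 => /(congr1 trmx); rewrite trmxK tr_scalar_mx.
Qed.

(** * The relevant blocks of the Seifert complex *)

Section SeifertChains.
Variables (K : fieldType) (n g m : nat) (v : int).
Variables (alpha : 'I_m -> nat) (beta : 'I_m -> int).
Local Notation N := (seifert_space g v alpha beta).
Variable rho : gen N -> 'M[K]_n.+1.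
Local Notation W := (wedge g m).

Hypothesis rho_unit : forall x, rho x \is a GRing.unit.
Variable omega : K.
Hypothesis rho_h : rho (gh g m) = omega%:M.

Lemma cellmxE (S T : finType) (c : S -> T -> seq (bool * word (gen N))) :
  cellmx rho c = cellblk (fun s t => coefmx rho (c s t)).
Proof. by []. Qed.

Definition wedge1 : 'M[K]_(_, _) :=
  @select K n.+1 W (seifert_gen g m) Some.
Definition fibre1 : 'M[K]_(_, _) :=
  @select K n.+1 _ (seifert_gen g m) (fun _ : unit => gh g m).
Definition wedge2 : 'M[K]_(_, _) :=
  @select K n.+1 W (seifert_rel g m) inl.
Definition meridian2 : 'M[K]_(_, _) :=
  @select K n.+1 (option 'I_m) (seifert_rel g m) inr.

Let delta : K := omega^-1 - 1.

Let inv_h : (rho (gh g m))^-1 = omega^-1%:M.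
Proof.
rewrite rho_h -[LHS]/(invmx _).
by rewrite invmx_scalar.
Qed.

Lemma fibre_bd1 : fibre1 *m bd1 rho = delta%:M.
Proof.
rewrite /fibre1 /bd1 cellmxE select_mul -cellblk_scalar.
apply: eq_cellblk => -[] []; rewrite eqxx /coefmx 2!big_cons big_nil /=.
rewrite expr0 expr1 scale1r scaleN1r !mulmx1 trmx1 addr0.
by rewrite -[invmx _]/((rho (gh g m))^-1) inv_h tr_scalar_mx -raddfB.
Qed.

(** The Fox derivative of [x, h] by x is 1 - x h x^-1, and h acts by a scalar. *)
Lemma wedge_bd2 : wedge2 *m bd2 rho *m wedge1^T = (- delta)%:M.
Proof.
rewrite /wedge2 /wedge1 /bd2 cellmxE select_mul mul_select_tr -cellblk_scalar.
apply: eq_cellblk => x y; rewrite /= (_ : (Some x == Some y) = (x == y)) // /coefmx.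
case: eqVneq => [_|_]; rewrite ?cats0 /= ?big_nil //.
rewrite 2!big_cons big_nil /= expr0 expr1 scale1r scaleN1r trmx1 addr0.
rewrite -[X in 1%:M - X^T]/(wordmx rho
  (winv [:: (Some x, false); (gh g m, false); (Some x, true)])).
rewrite wordmx_inv // !wordmx_cons /= mulr1 rho_h.
have hC : omega%:M * rho (Some x) = rho (Some x) * omega%:M.
  exact/esym/scalar_mxC.
rewrite mulrA -hC mulrK // -rho_h inv_h tr_scalar_mx.
by rewrite -raddfB opprB.
Qed.

(** Hence the boundary torus of a solid torus contributes nothing to the meridian block of d3. *)
Lemma fill_inl u w (t : bool * word (seifert_gen g m) * seifert_rel g m) k :
  t \in fill u w -> t.2 != inr k.
Proof.
have conj l s : (forall t, t \in s -> t.2 != inr k) ->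
    forall t, t \in @fill_conj g m l s -> t.2 != inr k.
  by move=> sP _ /mapP[t' /sP t'k ->].
have letter l w' : forall t, t \in @fill_letter g m l w' -> t.2 != inr k.
  elim: w' => //= l' w' IHw t'; rewrite mem_cat => /orP[|]; last exact: conj.
  by case: l l' {IHw} => [[x|] e] [[y|] e'] //=; rewrite inE => /eqP->.
elim: u t => //= l u IHu t; rewrite mem_cat => /orP[|]; last exact: letter.
exact: conj.
Qed.

Lemma meridian_bd3 : bd3 rho *m meridian2^T =
  cellblk (fun k l => if k == l
    then ((wordmx rho (core g alpha beta k))^-1 - 1)^T else 0).
Proof.
rewrite /meridian2 /bd3 cellmxE mul_select_tr.
apply: eq_cellblk => k l; rewrite /coefmx big_map big_filter.
rewrite [sphere _]/(seifert_sphere g v alpha beta k) /seifert_sphere big_cat /=.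
rewrite 2!big_cons big_nil /= [X in _ + X]big1_seq => [|t]; last first.
  case/andP=> /eqP t_l; rewrite mem_rev => /mapP[t' /fill_inl t'_inl t_t'].
  by have := t'_inl l; rewrite -t_l t_t' eqxx.
rewrite addr0 (_ : (inr k == inr l) = (k == l)) //; case: eqP => // _.
rewrite expr0 expr1 scale1r scaleN1r trmx1 addr0 wordmx_inv //.
by rewrite -[1%:M]trmx1 -raddfB.
Qed.

(** The core is q^-t h^s with s alpha + t beta = 1. As q^alpha = h^-beta, its power alpha is h^(t
    beta + s alpha) = h. *)
Lemma core_pow j : coprimez (alpha j)%:Z (beta j) ->
  (forall r, wordmx rho (relator r) = 1%:M) ->
  wordmx rho (core g alpha beta (Some j)) ^+ alpha j = rho (gh g m).
Proof.
move=> cop rel1; rewrite /core; case: egcdzP => s t st _.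
have {st} st : s * (alpha j)%:Z + t * beta j = 1 by rewrite st; apply/eqP.
have q_pow : rho (gq g j) ^ (alpha j)%:Z * rho (gh g m) ^ beta j = 1.
  by have := rel1 (inr (Some j)); rewrite /= wordmx_cat !wordmx_wpow.
rewrite wordmx_cat !wordmx_wpow.
have hU := rho_unit (gh g m); have qU := rho_unit (gq g j).
have hC x : GRing.comm (rho (gh g m)) x by rewrite rho_h; apply/esym/scalar_mxC.
rewrite -[_ ^+ _]/(_ ^ (alpha j)%:Z).
rewrite exprMz_comm ?unitrXz //; last first.
  by apply: commrXz; apply: commr_sym; apply: commrXz; apply: hC.
rewrite !exprz_exp.
have -> : rho (gq g j) ^ (- t * (alpha j)%:Z) = rho (gh g m) ^ (t * beta j).
  have qE : rho (gq g j) ^ (alpha j)%:Z = rho (gh g m) ^ (- beta j).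
    have := congr1 (fun M => M * rho (gh g m) ^ (- beta j)) q_pow.
    by rewrite -mulrA -exprzDr // subrr expr0z mulr1 mul1r.
  by rewrite (mulrC (- t)) -[LHS]exprz_exp qE exprz_exp mulrNN mulrC.
by rewrite -exprzDr // addrC st expr1z.
Qed.

End SeifertChains.

(** * Algebraic integers from matrices of finite order *)

Section Integrality.
Variable K : closedFieldType.
Local Notation integral := (integralOver (intr : int -> K)).

Lemma integral_unity_root N (x : K) : (0 < N)%N -> x ^+ N = 1 -> integral x.
Proof.
move=> N_gt0 xN; exists ('X^N - 1); first exact: monicXnsubC.
by rewrite rmorphB rmorph1 /= map_polyXn rootE !hornerE ?hornerXn xN subrr.
Qed.

(* Over K, 1 + X + ... + X^(k-1) is a product of factors X - z with z a root  *)
(* of unity, and the eigenvalues of each C - z are algebraic integers.        *)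
Lemma integral_det_geometric n N k (C : 'M[K]_n.+1) :
  (0 < N)%N -> (0 < k)%N -> C ^+ N = 1 -> integral (\det (\sum_(i < k) C ^+ i)).
Proof.
move=> N_gt0 k_gt0 CN; pose p : {poly K} := \sum_(i < k) 'X^i.
have pE : ('X - 1) * p = 'X^k - 1 by rewrite subrX1.
have p_monic : p \is monic.
  have := monicXnsubC (1 : K) k_gt0; rewrite -pE.
  by rewrite (monicMl _ (monicXsubC 1)).
have [s] := closed_field_poly_normal p.
rewrite (eqP p_monic) scale1r => ps.
have -> : \sum_(i < k) C ^+ i = horner_mx C p.
  by rewrite rmorph_sum; apply: eq_bigr => i _; rewrite rmorphXn /= horner_mx_X.
have s_unity z : z \in s -> z ^+ k = 1.
  rewrite -root_prod_XsubC -ps => /rootP pz.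
  have /(congr1 (horner^~ z)) := pE.
  rewrite hornerM pz mulr0 !hornerE ?hornerXn => /esym/eqP.
  by rewrite subr_eq0 => /eqP.
rewrite ps rmorph_prod /=.
elim: s s_unity {ps} => [_|z s IHs s_unity].
  by rewrite big_nil det1; apply: integral1.
rewrite big_cons det_mulmx; apply: integral_mul; last first.
  by apply: IHs => y ys; apply: s_unity; rewrite inE ys orbT.
rewrite rmorphB /= horner_mx_X horner_mx_C.
have z_int : integral z by apply: (integral_unity_root k_gt0); rewrite s_unity ?mem_head.
have [r] := closed_field_poly_normal (char_poly C).
rewrite (eqP (char_poly_monic C)) scale1r => rE.
(* Up to the sign (-1)^(n+1), the determinant of C - z is the characteristic polynomial of C at z, a
   product of differences of roots of unity. *)
have -> : C - z%:M = (-1) *: (z%:M - C) by rewrite scaleN1r opprB.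
have -> : z%:M - C = map_mx (horner_eval z) (char_poly_mx C).
  by apply/matrixP=> i j; rewrite !mxE /horner_eval !hornerE hornerMn hornerX.
rewrite detZ det_map_mx -/(char_poly C) rE.
apply: integral_mul.
  have -> : (-1) ^+ n.+1 = ((-1) ^+ n.+1)%:~R :> K by rewrite rmorphXn rmorphN1.
  exact: integral_id.
rewrite /= horner_evalE horner_prod big_seq.
elim/big_ind: _ => [|x y|d]; [exact: integral1 | exact: integral_mul|].
rewrite -root_prod_XsubC -rE -eigenvalue_root_char => /eigenvalueP[u Cu u0].
rewrite !hornerE; apply: integral_sub => //; apply: (integral_unity_root N_gt0).
have uN i : u *m C ^+ i = d ^+ i *: u.
  elim: i => [|i IHi]; first by rewrite expr0 mulmx1 scale1r.
  by rewrite exprSr mulmxA IHi -scalemxAl Cu scalerA -exprSr.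
have := uN N; rewrite CN mulmx1 => uE; apply/eqP; rewrite -subr_eq0.
have: (d ^+ N - 1) *: u = 0 by rewrite scalerBl -uE scale1r subrr.
by move/eqP; rewrite scaler_eq0 (negPf u0) orbF.
Qed.

End Integrality.

(** * The torsion of the Seifert space *)

Section SeifertTorsion.
Variables (K : closedFieldType) (n g m : nat) (v : int).
Variables (alpha : 'I_m -> nat) (beta : 'I_m -> int).
Local Notation N := (seifert_space g v alpha beta).
Variable rho : gen N -> 'M[K]_n.+1.
Hypothesis g_ge1 : (1 <= g)%N.
Hypothesis alpha_gt1 : forall j, (1 < alpha j)%N.
Hypothesis coprime_alpha_beta : forall j, coprimez (alpha j)%:Z (beta j).
Hypothesis rho_SL : SL_representation rho.
Hypothesis rho_irr : irreducible_representation rho.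
Local Notation integral := (integralOver (intr : int -> K)).
Local Notation h := (gh g m).
Local Notation tau := (reidemeister_torsion rho).

Let rho_unit x : rho x \is a GRing.unit.
Proof. by rewrite -[_ \is a _]/(_ \in unitmx) unitmxE (rho_SL.1 x) unitr1. Qed.

Let rel1 r : wordmx rho (relator r) = 1%:M.
Proof. exact: rho_SL.2. Qed.

(** The relators [x, h] make h central. *)
Lemma fibre_scalar : exists omega, rho h = omega%:M.
Proof.
apply: Schur_scalar rho_irr _ => // -[x|]; last by [].
by apply/commr_sym/(commutator_comm rho_unit)/(rel1 (inl x)).
Qed.

Let sizes (S T U : finType) : #|U| = (#|S| + #|T|)%N ->
  (\sum_(i < #|S|) n.+1 + \sum_(i < #|T|) n.+1 = \sum_(i < #|U|) n.+1)%N.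
Proof. by move=> ->; rewrite !sum_nat_const !card_ord mulnDl. Qed.

Let size1 : #|seifert_gen g m| = (#|wedge g m| + #|{: unit}|)%N.
Proof. by rewrite card_option card_unit addn1. Qed.

Let size2 : #|seifert_rel g m| = (#|wedge g m| + #|{: option 'I_m}|)%N.
Proof. exact: card_sum. Qed.

Let wedge_size : (\sum_(i < #|wedge g m|) n.+1 = n.+1 * (g.*2 + m))%N.
Proof. by rewrite sum_nat_const card_ord !card_sum !card_ord addnn mulnC. Qed.

Let meridian_size : (\sum_(i < #|{: option 'I_m}|) n.+1 = n.+1 * m.+1)%N.
Proof. by rewrite sum_nat_const card_ord card_option card_ord mulnC. Qed.

Let unit_size : (\sum_(i < #|{: unit}|) n.+1 = n.+1)%N.
Proof. by rewrite sum_nat_const card_ord card_unit mul1n. Qed.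

Let inj_Some : injective (Some : wedge g m -> seifert_gen g m).
Proof. by move=> x y []. Qed.
Let inj_fibre : injective (fun _ : unit => h). Proof. by case=> -[]. Qed.
Let inj_inl : injective (inl : wedge g m -> seifert_rel g m).
Proof. by move=> x y []. Qed.
Let inj_inr : injective (inr : option 'I_m -> seifert_rel g m).
Proof. by move=> x y []. Qed.

Let IJ1 : wedge1 K n g m *m (fibre1 K n g m)^T = 0.
Proof. exact: select_orthogonal. Qed.
Let IJ2 : wedge2 K n g m *m (meridian2 K n g m)^T = 0.
Proof. exact: select_orthogonal. Qed.

Section Omega.
Variable omega : K.
Hypothesis rho_h : rho h = omega%:M.

Let omega_unity : omega ^+ n.+1 = 1.
Proof. by rewrite -det_scalar -rho_h rho_SL.1. Qed.

(* The solid torus None has core h, whence the value 1. *)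
Definition multiplicity (k : option 'I_m) : nat := oapp alpha 1 k.

Lemma core_multiplicity k :
  wordmx rho (core g alpha beta k) ^+ multiplicity k = omega%:M.
Proof.
rewrite -rho_h; case: k => [j|]; first exact: (core_pow rho_unit rho_h).
by rewrite expr1 wordmx1.
Qed.

Lemma nondegenerate_integral : omega != 1 -> integral tau.
Proof.
move=> omega1; rewrite /reidemeister_torsion.
have [ac|/negPf nac] := boolP (acyclic_complex (bd1 rho) (bd2 rho) (bd3 rho)).
  2: by rewrite /complex_torsion nac; apply: integral0.
have omega0 : omega != 0.
  by apply/eqP=> o0; move/eqP: omega_unity; rewrite o0 expr0n eq_sym oner_eq0.
have [e e2] := complex_torsion_split (sizes size1) (sizes size2)
  (select_orthonormal K n.+1 inj_Some) IJ1 (select_orthonormal K n.+1 inj_fibre)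
  (select_orthonormal K n.+1 inj_inl) IJ2 (select_orthonormal K n.+1 inj_inr) ac.
rewrite -/(fibre1 K n g m) -/(wedge1 K n g m).
rewrite -/(wedge2 K n g m) -/(meridian2 K n g m).
rewrite (fibre_bd1 rho_h) (wedge_bd2 rho_unit rho_h).
rewrite (meridian_bd3 rho_unit) det_cellblk_diag !det_scalar.
move: (complex_torsion _ _ _) => tau.
rewrite wedge_size unit_size; set delta := omega^-1 - 1 => torsionE.
have delta0 : delta != 0 by rewrite subr_eq0 invr_eq1.
have mult_gt0 k : (0 < multiplicity k)%N by case: k => [j|] //=; apply: ltnW.
(* The inverse of the core, as it occurs in [meridian_bd3]; its order divides the multiplicity times
   n+1. *)
pose C k := (wordmx rho (core g alpha beta k))^-1.
have C_pow k : C k ^+ multiplicity k = omega^-1%:M.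
  by rewrite exprVn core_multiplicity -[LHS]/(invmx _) invmx_scalar.
pose S k := \sum_(i < multiplicity k) C k ^+ i.
have detS k : \det (C k - 1)^T * \det (S k) = delta ^+ n.+1.
  by rewrite det_tr -det_mulmx mulmxE -subrX1 C_pow -raddfB det_scalar.
have S_int k : integral (\det (S k)).
  apply: (@integral_det_geometric _ _ (multiplicity k * n.+1)) => //.
    by rewrite muln_gt0 mult_gt0.
  by rewrite exprM C_pow -rmorphXn /= exprVn omega_unity invr1.
have -> : tau = e * (-1) ^+ (n.+1 * (g.*2 + m)) * delta ^+ (n.+1 * g.-1.*2) *
    \prod_k \det (S k).
  (* The factor multiplied in collects delta^(n+1) for each of the m + 1 solid tori and once more
     for h. *)
  apply: (@mulIf _ (delta ^+ (n.+1 * m.+2))); first exact: expf_neq0.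
  have deltaE : delta ^+ (n.+1 * m.+2) =
      \prod_k \det (C k - 1)^T * \prod_k \det (S k) * delta ^+ n.+1.
    rewrite -big_split /= (eq_bigr _ (fun k _ => detS k)) prodr_const.
    rewrite card_option card_ord -exprM -exprD; congr (_ ^+ _); ring.
  rewrite [in LHS]deltaE [LHS](_ : _ = tau * \prod_k \det (C k - 1)^T * delta ^+ n.+1 *
      \prod_k \det (S k)); last by ring.
  rewrite [X in X * _]torsionE [(- delta) ^+ _]exprNn.
  have -> : (n.+1 * (g.*2 + m) = n.+1 * g.-1.*2 + n.+1 * m.+2)%N.
    by rewrite -mulnDr; congr (_ * _)%N; lia.
  rewrite [delta ^+ (_ + _)]exprD.
  by move: ((-1) ^+ _) (delta ^+ _) (delta ^+ _) => x y z; ring.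
apply: integral_mul; last first.
  by elim/big_ind: _ => //; [exact: integral1 | exact: integral_mul].
have pow_int x k : integral x -> integral (x ^+ k).
  move=> x_int; elim: k => [|k IHk]; first exact: integral1.
  by rewrite exprS; apply: integral_mul.
apply: integral_mul; first apply: integral_mul; last apply: pow_int.
- exact: (integral_unity_root (isT : (0 < 2)%N)).
- by apply: pow_int; apply: integral_opp; apply: integral1.
apply: integral_sub; last exact: integral1.
by apply: (integral_unity_root (ltn0Sn n)); rewrite exprVn omega_unity invr1.
Qed.

End Omega.

(** By Schur all images are scalar, so every line is stable and the dimension is 1. Determinant 1
    makes rho trivial, hence d1 = 0, whereas acyclicity requires d1 to have full rank. *)
Lemma scalar_not_acyclic : (forall x y, GRing.comm (rho x) (rho y)) ->
  ~~ acyclic_complex (bd1 rho) (bd2 rho) (bd3 rho).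
Proof.
move=> comm; apply/negP=> ac.
have scal x : exists a, rho x = a%:M by apply: Schur_scalar rho_irr _.
have wscal w : exists a, wordmx rho w = a%:M.
  apply: Schur_scalar rho_irr _ => // x; apply/commr_sym.
  by apply: wordmx_commute => y; apply: comm.
have [_ irr] := rho_irr.
have : row_full (delta_mx 0 0 : 'M[K]_n.+1).
  apply: irr => [w|]; last by rewrite -mxrank_eq0 mxrank_delta.
  have [a ->] := wscal w; rewrite tr_scalar_mx -scalemx1 -scalemxAr mulmx1.
  exact: scalemx_sub.
rewrite /row_full mxrank_delta eqSS => /eqP n0.
have rho1 x : rho x = 1.
  have [a rho_a] := scal x; have := rho_SL.1 x; rewrite rho_a det_scalar -n0.
  by rewrite expr1 => ->.
have bd1_0 : bd1 rho = 0.
  rewrite /bd1 cellmxE -cellblk0; apply: eq_cellblk => x [].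
  rewrite /coefmx 2!big_cons big_nil /= rho1 expr0 expr1 scale1r scaleN1r addr0.
  by rewrite -[invmx 1]/(1^-1) invr1 mulmx1 subrr.
by have := acyclic_rank1 ac; rewrite {1}bd1_0 mxrank0 unit_size.
Qed.

Lemma degenerate_not_acyclic : rho h = 1 ->
  ~~ acyclic_complex (bd1 rho) (bd2 rho) (bd3 rho).
Proof.
move=> h1; apply/negP=> ac.
have wedge0 : wedge2 K n g m *m bd2 rho *m (wedge1 K n g m)^T = 0.
  by rewrite (wedge_bd2 rho_unit h1) invr1 subrr oppr0 raddf0.
have := degenerate_split (sizes size1) (sizes size2)
  (select_orthonormal K n.+1 inj_Some) IJ1 (select_orthonormal K n.+1 inj_fibre)
  (select_orthonormal K n.+1 inj_inl) IJ2 ac wedge0.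
rewrite -/(meridian2 K n g m) (meridian_bd3 rho_unit); set D := cellblk _ => rk.
(* In units of the dimension, the bound reads rank D + (2 g + m) <= (m + 1) + 1, which with g >= 1
   leaves only g = 1 and D = 0. *)
have /andP[D0 /eqP g1] : (\rank D == 0)%N && (g == 1)%N.
  by move: (\rank D) rk => r; rewrite wedge_size meridian_size unit_size; nia.
have core1 k : wordmx rho (core g alpha beta k) = 1.
  move: D0; rewrite mxrank_eq0 -cellblk0 /D => /eqP/cellblk_inj/(_ k k).
  rewrite eqxx => /(congr1 trmx); rewrite trmxK trmx0 => /eqP; rewrite subr_eq0.
  by rewrite invr_eq1 => /eqP.
(* As h = 1, the core gives q^t = 1 and the meridian gives q^alpha = 1; the Bezout relation then
   gives q = 1. *)
have q1 j : rho (gq g j) = 1.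
  have := core1 (Some j); have := coprime_alpha_beta j.
  rewrite /core; case: egcdzP => s t st _ /eqP cop.
  rewrite cop in st.
  rewrite wordmx_cat !wordmx_wpow // h1 exp1rz mulr1 -invr_expz => /eqP.
  rewrite invr_eq1 => /eqP qt.
  have := rel1 (inr (Some j)); rewrite /= wordmx_cat !wordmx_wpow //.
  rewrite h1 exp1rz mulr1 => qa.
  rewrite -[LHS]expr1z -st exprzDr // [s * _]mulrC -[X in X * _]exprz_exp qa.
  by rewrite -[X in _ * X]exprz_exp qt !exp1rz mulr1.
have ord_g (i : 'I_g) : i = Ordinal g_ge1.
  by apply: val_inj; case: i => i lti /=; lia.
have ab : GRing.comm (rho (ga m (Ordinal g_ge1))) (rho (gb m (Ordinal g_ge1))).
  apply: (commutator_comm rho_unit).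
  (* With h and all q_j trivial and g = 1, this relator reduces to [a_1, b_1]. *)
  have := rel1 (inr None); rewrite /= !wordmx_cat wordmx_wpow // h1 exp1rz mulr1.
  rewrite [X in X * _]wordmx_trivial ?mul1r.
    2: by move=> l /flattenP[w /mapP[j _ ->]]; rewrite inE => /eqP->; apply: q1.
  suff -> : enum 'I_g = [:: Ordinal g_ge1] by [].
  by apply: (inj_map val_inj); rewrite val_enum_ord [in LHS]g1.
apply/negP: ac; apply: scalar_not_acyclic => x y.
case: x => [[[i|i]|j]|]; last by rewrite h1; apply/commr_sym/commr1.
- case: y => [[[i'|i']|j']|]; last by rewrite h1; apply: commr1.
  + by rewrite (ord_g i) (ord_g i').
  + by rewrite (ord_g i) (ord_g i'); apply: ab.
  + by rewrite q1; apply: commr1.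
- case: y => [[[i'|i']|j']|]; last by rewrite h1; apply: commr1.
  + by rewrite (ord_g i) (ord_g i'); apply: commr_sym; apply: ab.
  + by rewrite (ord_g i) (ord_g i').
  + by rewrite q1; apply: commr1.
- by rewrite q1; apply/commr_sym/commr1.
Qed.

Lemma integral_torsion : integral tau.
Proof.
have [omega rho_h] := fibre_scalar.
have [omega1|] := eqVneq omega 1; last exact: nondegenerate_integral.
have h1 : rho h = 1 by rewrite rho_h omega1.
rewrite /reidemeister_torsion /complex_torsion (negPf (degenerate_not_acyclic h1)).
exact: integral0.
Qed.

End SeifertTorsion.

Theorem proposition1p3 (R : realType) (g m : nat) (v : int)
    (alpha : 'I_m -> nat) (beta : 'I_m -> int)
    (g_ge1 : (1 <= g)%N)
    (alpha_gt1 : forall j, (1 < alpha j)%N)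
    (coprime_alpha_beta : forall j, coprimez (alpha j)%:Z (beta j))
    (n : nat) (rho : gen (seifert_space g v alpha beta) -> 'M[R[i]]_n)
    (rho_SL : SL_representation rho)
    (rho_irr : irreducible_representation rho) :
  integralOver (intr : int -> R[i]) (reidemeister_torsion rho).
Proof.
(* Irreducibility includes 0 < n, which excludes dimension 0. *)
case: n rho rho_SL rho_irr => [|n] rho rho_SL rho_irr; first by case: rho_irr.
exact: integral_torsion.
Qed.
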